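(* For $r\in\mathbb{N}$ and $m\in\mathbb{N}_0$, $$\sum_{j=0}^{r-1}\binom{r-1}{j}\frac{(-1)^j\zeta(2)^{r-1-j}}{m!}\,\zeta_{MT,j+m}(\{2\}^{j},\{1\}^{m};1)=\sum_{j=0}^{r-1}\binom{r-1}{j}(m+1)_j\,\zeta_{MT,r}(\{2\}^{r-1-j},\{1\}^{j},0;m+1+j).$$
   Context: $\mathbb{N}=\{1,2,3,\dots\}$ and $\mathbb{N}_0=\mathbb{N}\cup\{0\}$. $\{a\}^{n}$ denotes $n$ repetitions of $a$ (empty if $n=0$). $\zeta$ is the Riemann zeta function. $(x)_j=x(x+1)\cdots(x+j-1)$ is the Pochhammer symbol, with $(x)_0=1$. The Mordell-Tornheim $n$-ple zeta function is $$\zeta_{MT,n}(s_1,\dots,s_n;s_{n+1})=\sum_{m_1,\dots,m_n=1}^\infty\frac{1}{m_1^{s_1}\cdots m_n^{s_n}(m_1+\cdots+m_n)^{s_{n+1}}},$$ defined by this series where it converges absolutely, and continued meromorphically to all of $\mathbb{C}^{n+1}$.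
   Formalization: For m = 0 the identity has no finite meaning, since ζ_MT,r({2}^{r-1},0;1) diverges and is a pole and ζ_MT,0(;1) is 1/0; it is stated in the extended reals, where for m = 0 both sides are +∞, and for m ≥ 1 all values are also asserted finite. *)

(* Defs.v *)
From HB Require Import structures.
From mathcomp Require Import all_boot all_order all_algebra.
From mathcomp Require Import all_classical all_reals all_analysis.
Set Implicit Arguments.
Unset Strict Implicit.
Unset Printing Implicit Defensive.
Import Order.TTheory GRing.Theory Num.Theory.
Import numFieldNormedType.Exports.
Local Open Scope classical_set_scope.
Local Open Scope ring_scope.

Definition pochhammer (R : pzSemiRingType) (x : R) (j : nat) : R :=
  \prod_(i < j) (x + i%:R).

(* The Dirichlet series of the Riemann zeta function; meaningful for s > 1. *)
Definition zeta (R : realType) (s : R) : R := limn (series (riemannR s)).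

(* mt_zeta [:: s_1; ...; s_n] t is zeta_{MT,n}(s_1,...,s_n;t) for real
   arguments, n being the length of the list.  The terms being nonnegative, the
   series is taken in [0, +oo]: it converges absolutely iff its value is not
   +oo.  The inverse is the one of \bar R, for which 0^-1 = +oo; this matters
   only for n = 0, where m_1 + ... + m_n is the empty sum: for t <> 0 the only
   term is (0 `^ t)^-1 = +oo. *)
Definition mt_zeta (R : realType) (s : seq R) (t : R) : \bar R :=
  (\esum_(k in [set k : {ffun 'I_(size s) -> nat} | forall i, (0 < k i)%N])
     (((\prod_(i < size s) (k i)%:R `^ s`_i) *
       (\sum_(i < size s) (k i)%:R) `^ t)%:E)^-1)%E.

(* Main.v *)
Require Import Defs.
From mathcomp Require Import all_boot all_order all_algebra.
From mathcomp Require Import all_classical all_reals all_analysis.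
From mathcomp Require Import measurable_realfun.
From mathcomp Require Import ring lra.
Set Implicit Arguments.
Unset Strict Implicit.
Unset Printing Implicit Defensive.
Import Order.TTheory GRing.Theory Num.Theory.
Import numFieldNormedType.Exports.
Local Open Scope classical_set_scope.
Local Open Scope ring_scope.

(** Both sides are the same integral, seen from the two ends of the unit
    interval.  Write Li_s(x) for the sum of x^n / n^s over n >= 1, so that
    Li_0(x) = x / (1 - x) and Li_1(x) = - ln (1 - x).  Since the integral of
    x^(N-1) (- ln x)^k over ]0, 1[ is k! / N^(k+1), expanding a product of
    polylogarithms and integrating term by term gives
      k! zeta_MT(s_1, ..., s_n; k+1)
        = integral of Li_(s_1)(x) ... Li_(s_n)(x) (- ln x)^k dx / x
    ([mt_zeta_integral]); every term is nonnegative, so this holds in [0, +oo]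
    without any convergence hypothesis.

    By the binomial formula the left-hand side is then the integral of
      (zeta(2) - Li_2(x))^(r-1) (- ln (1 - x))^m / (m! x).
    Replacing x by 1 - x, and using Euler's reflection formula
      Li_2(x) + Li_2(1 - x) + ln x ln (1 - x) = zeta(2)
    ([polylog2_reflection]), the integrand becomes
      (Li_2(x) + Li_1(x) (- ln x))^(r-1) (- ln x)^m / (m! (1 - x)),
    and expanding this binomial gives the right-hand side: the factor
    1 / (1 - x) = Li_0(x) / x accounts for the argument 0, and the quotient
    (m + j)! / m! is the Pochhammer symbol.

    The left-hand side has signs, so its terms must be finite before they can be
    added under one integral.  For m >= 1 they are bounded, up to a constant, by
    the integral of (- ln x)^m / (1 - x), because Li_2 <= zeta(2) and, by the
    reflection formula, Li_1(x) (- ln x) <= zeta(2).  For m = 0 the term j = 0 is infinite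
    on both sides, while the other terms on the left are finite, and the
    identity reads +oo = +oo. *)

(** * Polylogarithms on the unit interval *)

Section Polylogarithm.
Context {R : realType}.
Implicit Types (a x : R) (n : nat).

(** The index starts at 0, hence the shift: the term of index n is
    x^(n+1) / (n+1)^a. *)
Definition polylog_term a x n : R := x ^+ n.+1 * riemannR a n.

Definition polylog a x : R := limn (series (polylog_term a x)).

Lemma zeta_polylog a : zeta a = polylog a 1.
Proof.
rewrite /zeta /polylog; congr (limn (series _)).
by apply/funext => n; rewrite /polylog_term expr1n mul1r.
Qed.

Lemma riemannR_le1 a n : 0 <= a -> riemannR a n <= 1.
Proof.
move=> a0; rewrite /riemannR invf_le1 ?powR_gt0 ?ltr0n//.
by rewrite -[leLHS](powRr0 n.+1%:R) ler_powR// ler1n.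
Qed.

Lemma polylog_term_ge0 a x n : 0 <= a -> 0 <= x -> 0 <= polylog_term a x n.
Proof. by move=> a0 x0; rewrite mulr_ge0 ?exprn_ge0// ltW// riemannR_gt0. Qed.

Lemma is_cvg_polylog a x : 0 <= a -> 0 <= x < 1 ->
  cvgn (series (polylog_term a x)).
Proof.
move=> a0 /andP[x0 x1].
apply: (@series_le_cvg _ _ (geometric 1 x)) => [n|n|n|].
- exact: polylog_term_ge0.
- by rewrite geometric_ge0.
- rewrite /= mul1r /polylog_term exprS -mulrA mulrCA ler_piMr ?exprn_ge0//.
  by rewrite mulr_ile1 ?riemannR_le1// ltW// riemannR_gt0.
- by apply: is_cvg_geometric_series; rewrite ger0_norm.
Qed.

(** Telescoping: 1 / (n+1)^2 <= 1 / n - 1 / (n+1) for n >= 1. *)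
Lemma is_cvg_zeta2 : cvgn (series (riemannR (2 : R))).
Proof.
apply: nondecreasing_is_cvgn.
  by apply: nondecreasing_series => n _; rewrite ltW// riemannR_gt0.
exists 2 => _ [n _ <-].
(* The bound includes n = 0, where 0^-1 = 0. *)
suff : series (riemannR (2 : R)) n <= 2 - n%:R^-1.
  by move/le_trans; apply; rewrite gerBl.
elim: n => [|[_|n ih]]; first by rewrite /series/= big_geq// invr0; lra.
  by rewrite /series/= big_nat1/riemannR powR1 invr1; lra.
rewrite /series/= big_nat_recr//=; apply: le_trans (lerD ih (lexx _)) _.
rewrite /riemannR (powR_mulrn 2)// expr2.
have n1 : (0 : R) < n.+1%:R by rewrite ltr0n.
rewrite -subr_ge0.
rewrite [leRHS](_ : _ = (n.+1%:R * n.+2%:R ^+ 2)^-1); last first.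
  rewrite -[n.+2]addn1 natrD; field.
  by rewrite !gt_eqF// addr_gt0.
by rewrite invr_ge0 mulr_ge0.
Qed.

Lemma is_cvg_polylog2 x : 0 <= x <= 1 ->
  cvgn (series (polylog_term 2 x)).
Proof.
move=> /andP[x0]; rewrite le_eqVlt => /orP[/eqP->|x1].
  rewrite (_ : polylog_term 2 1 = riemannR (2:R)); first exact: is_cvg_zeta2.
  by apply/funext => n; rewrite /polylog_term expr1n mul1r.
by apply: is_cvg_polylog => //; rewrite x0.
Qed.

Lemma polylog_ge a x n : 0 <= a -> 0 <= x ->
  cvgn (series (polylog_term a x)) -> series (polylog_term a x) n <= polylog a x.
Proof.
move=> a0 x0 cvx; apply: nondecreasing_cvgn_le => //.
by apply: nondecreasing_series => k _ _; apply: polylog_term_ge0.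
Qed.

Lemma polylog_ge0 a x : 0 <= a -> 0 <= x < 1 -> 0 <= polylog a x.
Proof.
move=> a0 x01; have := @polylog_ge a x 0%N a0.
rewrite /series/= big_geq//; apply; first by case/andP: x01.
exact: is_cvg_polylog.
Qed.

Lemma polylog_ge_id a x : 0 <= a -> 0 <= x < 1 -> x <= polylog a x.
Proof.
move=> a0 x01; have := @polylog_ge a x 1%N a0.
rewrite /series/= big_nat1/polylog_term/riemannR expr1 powR1 invr1 mulr1; apply.
  by case/andP: x01.
exact: is_cvg_polylog.
Qed.

(** From x^(n+1) <= x, term by term; the factor x is what makes Li_2(x)^j / x
    integrable at 0. *)
Lemma polylog2_le x : 0 <= x <= 1 -> polylog 2 x <= zeta 2 * x.
Proof.
move=> /[dup] x01 /andP[x0 x1].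
apply: limr_le; first exact: is_cvg_polylog2.
apply: nearW => n; apply: (@le_trans _ _ (series (riemannR (2 : R)) n * x)).
  rewrite /series/= mulr_suml; apply: ler_sum => i _.
  rewrite /polylog_term mulrC ler_wpM2l ?invr_ge0 ?powR_ge0//.
  by rewrite exprS ler_piMr// exprn_ile1.
rewrite ler_wpM2r//; apply: nondecreasing_cvgn_le; last exact: is_cvg_zeta2.
by apply: nondecreasing_series => k _ _; rewrite ltW// riemannR_gt0.
Qed.

Lemma zeta2_ge0 : 0 <= zeta (2 : R).
Proof.
rewrite zeta_polylog; have := @polylog_ge 2 1 0%N.
rewrite /series/= big_geq//; apply => //.
by apply: is_cvg_polylog2; rewrite ler01 lexx.
Qed.

Lemma polylog2_le_zeta2 x : 0 <= x <= 1 -> polylog 2 x <= zeta 2.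
Proof.
move=> x01; apply: le_trans (polylog2_le x01) _.
by rewrite ler_piMr ?zeta2_ge0//; case/andP: x01.
Qed.

Lemma polylog0E x : 0 <= x < 1 -> polylog 0 x = x / (1 - x).
Proof.
move=> /andP[x0 x1]; apply/cvg_lim => //.
rewrite (_ : polylog_term 0 x = geometric x x).
  by apply: cvg_geometric_series; rewrite ger0_norm.
by apply/funext => n; rewrite /polylog_term /riemannR powRr0 invr1 mulr1 exprS.
Qed.

End Polylogarithm.

(** * Derivatives and the reflection formula of the dilogarithm *)

Section PolylogarithmDerivative.
Context {R : realType}.
Implicit Types (a x : R) (n : nat).

Let coef a n : R := if n is k.+1 then riemannR a k else 0.

Let polylogE a : polylog a = fun x => limn (pseries (coef a) x).
Proof.
apply/funext => x; rewrite /polylog /lim; congr get; apply/funext => l.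
rewrite -[RHS]cvg_shiftS; congr (_ @ \oo --> l); apply/funext => n /=.
rewrite /pseries /series/= big_nat_recl//= mul0r add0r.
by apply: eq_bigr => i _; rewrite /polylog_term mulrC.
Qed.

Let coef_diffs a n : pseries_diffs (coef a) n = n.+1%:R * riemannR a n.
Proof. by []. Qed.

Let riemannR_le_inv a n : 1 <= a -> n.+1%:R * riemannR a n <= 1.
Proof.
move=> a1; rewrite /riemannR ler_pdivrMr ?powR_gt0 ?ltr0n// mul1r.
by rewrite -[leLHS]powRr1// ler_powR// ler1n.
Qed.

(** Coefficients of linear growth cover a polylogarithm series of order at least 1
    together with its first two formal derivatives, which is what termwise
    differentiation requires. *)
Lemma is_cvg_pseries_linear (c : R^nat) K : (forall n, 0 <= c n <= n.+1%:R) ->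
  0 <= K < 1 -> cvgn (pseries c K).
Proof.
move=> c01 /andP[K0 K1].
(* One factor L = sqrt K per power absorbs the linear growth; the other leaves
   a geometric series. *)
pose L := Num.sqrt K.
have L0 : 0 <= L by rewrite sqrtr_ge0.
have KL : K = L ^+ 2 by rewrite sqr_sqrtr.
have L1 : L < 1 by rewrite -sqrtr1 ltr_sqrt.
have nL n : n.+1%:R * L ^+ n <= (1 - L)^-1.
  rewrite -[leRHS]mul1r ler_pdivlMr ?subr_gt0//.
  apply: (@le_trans _ _ (1 - L ^+ n.+1)); last by rewrite gerBl exprn_ge0.
  rewrite -[X in _ <= X - _](expr1n _ n.+1) subrXX mulrC ler_wpM2l//.
    by rewrite subr_ge0 ltW.
  rewrite mulr_natl -[n.+1 in leLHS]card_ord -sumr_const; apply: ler_sum => i _.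
  by rewrite expr1n mul1r ler_wiXn2l ?(ltW L1)// -ltnS.
apply: (@series_le_cvg _ _ (geometric (1 - L)^-1 L)) => [n|n|n|].
- by rewrite mulr_ge0 ?exprn_ge0//; case/andP: (c01 n).
- by rewrite geometric_ge0// invr_ge0 subr_ge0 ltW.
- rewrite /= KL exprAC expr2 mulrA ler_wpM2r ?exprn_ge0//.
  apply: le_trans (nL n); rewrite ler_wpM2r ?exprn_ge0//.
  by case/andP: (c01 n).
- by apply: is_cvg_geometric_series; rewrite ger0_norm.
Qed.

Lemma is_derive_polylog a x : 1 <= a -> `|x| < 1 ->
  is_derive x 1 (polylog a)
    (limn (pseries (fun n => n.+1%:R * riemannR a n) x)).
Proof.
move=> a1 x1; have a0 : 0 <= a by rewrite (le_trans _ a1).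
have r0 n : 0 <= riemannR a n by rewrite ltW// riemannR_gt0.
have K0 : 0 <= (`|x| + 1) / 2 by rewrite divr_ge0// addr_ge0.
have K1 : 0 <= (`|x| + 1) / 2 < 1 by rewrite K0; lra.
rewrite polylogE.
apply: (@pseries_snd_diffs _ (coef a) ((`|x| + 1) / 2)).
- apply: is_cvg_pseries_linear => // -[|n] /=; first by rewrite lexx ler01.
  by rewrite r0/= (le_trans (riemannR_le1 _ a0))// ler1n.
- apply: (@is_cvg_pseries_linear (pseries_diffs (coef a)) _ _ K1) => n; rewrite coef_diffs mulr_ge0//=.
  by rewrite (le_trans (riemannR_le_inv n a1))// ler1n.
- apply: is_cvg_pseries_linear => // n.
  rewrite /pseries_diffs -/(pseries_diffs _ _) mulr_ge0 ?mulr_ge0//=.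
  by rewrite ler_piMr// riemannR_le_inv.
- by rewrite [ltRHS]ger0_norm//; lra.
Qed.

Lemma is_derive_polylog1 x : `|x| < 1 -> is_derive x 1 (polylog 1) (1 - x)^-1.
Proof.
move=> x1; rewrite [X in is_derive _ _ _ X](_ : _ =
    limn (pseries (fun n => n.+1%:R * riemannR 1 n) x)).
  exact: is_derive_polylog.
apply/esym/cvg_lim => //; rewrite -[_^-1]mul1r.
rewrite (_ : pseries _ x = series (geometric 1 x)).
  exact: cvg_geometric_series.
congr series; apply/funext => n; rewrite /= /riemannR powRr1//.
by rewrite divff ?pnatr_eq0.
Qed.

Lemma is_derive_polylog2 x : 0 < x < 1 ->
  is_derive x 1 (polylog 2) (polylog 1 x / x).
Proof.
move=> /andP[x0 x1]; rewrite [X in is_derive _ _ _ X](_ : _ =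
    limn (pseries (fun n => n.+1%:R * riemannR 2 n) x)).
  by apply: is_derive_polylog; [lra|rewrite ger0_norm// ltW].
apply/esym/cvg_lim => //.
rewrite (_ : pseries _ x = fun n => series (polylog_term 1 x) n / x).
  apply: cvgM; last exact: cvg_cst.
  apply: is_cvg_polylog => //.
  by rewrite ltW.
apply/funext => n; rewrite /pseries/series/= mulr_suml; apply: eq_bigr => i _.
rewrite /polylog_term /riemannR (powR_mulrn 2)// powRr1//.
have i0 : i.+1%:R != 0 :> R by rewrite pnatr_eq0.
rewrite expr2 exprS.
by move: i.+1%:R i0 => c c0; field; rewrite c0 (gt_eqF x0).
Qed.

Lemma derive0_cst_itv (f : R -> R) (a b u v : R) :
  (forall x, x \in `]a, b[ -> is_derive x 1 f 0) ->
  u \in `]a, b[ -> v \in `]a, b[ -> f u = f v.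
Proof.
move=> df; wlog uv : u v / u <= v.
  by move=> H uab vab; have [/H->//|/ltW/H<-//] := leP u v.
rewrite !in_itv/= => /andP[au ub] /andP[av vb].
have sub x : x \in `[u, v] -> x \in `]a, b[.
  rewrite !in_itv/= => /andP[ux xv].
  by rewrite (lt_le_trans au)//= (le_lt_trans xv).
have dfuv x : x \in `]u, v[ -> is_derive x 1 f (cst 0 x).
  by move=> xuv; apply/df/sub; exact: subset_itv_oo_cc xuv.
have cf : {within `[u, v], continuous f}.
  by apply: derivable_within_continuous => x /sub /df [].
have [c _ fE] := MVT_segment uv dfuv cf.
by apply/esym/eqP; rewrite -subr_eq0 fE mul0r.
Qed.

Lemma polylog0 a : polylog a 0 = 0 :> R.
Proof.
apply/cvg_lim => //; rewrite (_ : series _ = cst 0); first exact: cvg_cst.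
apply/funext => n; rewrite /series/= big1// => i _.
by rewrite /polylog_term expr0n mul0r.
Qed.

Lemma is_derive_ln_onem x : x < 1 ->
  is_derive x 1 (@ln R \o (fun y => 1 - y)) (- (1 - x)^-1).
Proof.
move=> x1; rewrite -mulrN1; apply: is_derive1_comp.
  by apply: is_derive1_ln; rewrite subr_gt0.
by rewrite -[X in is_derive _ _ _ X]add0r; apply: is_deriveB.
Qed.

(** Both functions vanish at 0 and have derivative 1 / (1 - x). *)
Lemma polylog1E x : 0 <= x < 1 -> polylog 1 x = - ln (1 - x).
Proof.
move=> /andP[x0 x1].
pose f := polylog 1 + (@ln R \o (fun y : R => 1 - y)).
suff : f x = f 0.
  rewrite /f !fctE polylog0 subr0 ln1 addr0 => /eqP.
  by rewrite addr_eq0 => /eqP.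
apply: (@derive0_cst_itv f (-1) 1).
- move=> y; rewrite in_itv/= => /andP[y0 y1].
  rewrite -(subrr (1 - y)^-1); apply: is_deriveD.
    by apply: is_derive_polylog1; rewrite ltr_norml y0.
  exact: is_derive_ln_onem.
- by rewrite in_itv/= x1 (lt_le_trans _ x0)// ltrN10.
- by rewrite in_itv/= ltr01 ltrN10.
Qed.

Lemma bernoulli_ineq n x : 0 <= x <= 1 -> 1 - n%:R * x <= (1 - x) ^+ n.
Proof.
move=> /andP[x0 x1]; elim: n => [|n ih]; first by rewrite mul0r subr0 expr0.
have ox : 0 <= 1 - x by lra.
rewrite exprSr -nat1r; apply: le_trans (ler_wpM2r ox ih).
by have : 0 <= n%:R * x * x by [rewrite !mulr_ge0]; lra.
Qed.

Lemma le_forall_slope (u v K : R) : 0 <= K ->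
  (forall y, 0 < y < 2^-1 -> u <= v + K * y) -> u <= v.
Proof.
move=> K0 H; apply/ler_addgt0Pr => e e0.
have K1 : 0 < K + 1 by rewrite ltr_wpDl.
pose y := Num.min (4^-1) (e / (K + 1)).
have y0 : 0 < y by rewrite lt_min invr_gt0 ltr0n divr_gt0.
have y2 : y < 2^-1 by rewrite gt_min; apply/orP; left; lra.
apply: le_trans (H y _) _; first by rewrite y0.
rewrite lerD2l; apply: (@le_trans _ _ ((K + 1) * y)).
  by rewrite ler_wpM2r ?(ltW y0)// lerDl.
by rewrite mulrC -ler_pdivlMr// ge_min lexx orbT.
Qed.

Let reflection x := polylog 2 x + polylog 2 (1 - x) + ln x * ln (1 - x).

(** The derivative is
    - ln (1 - x) / x + ln x / (1 - x) + ln (1 - x) / x - ln x / (1 - x) = 0. *)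
Let reflection_cst x y : 0 < x < 1 -> 0 < y < 1 -> reflection x = reflection y.
Proof.
move=> x01 y01; pose onem := fun y : R => 1 - y.
apply: (@derive0_cst_itv
  (polylog 2 + (polylog 2 \o onem) + @ln R * (@ln R \o onem)) 0 1);
  rewrite ?in_itv//=.
move=> z; rewrite in_itv/= => /andP[z0 z1].
have oz0 : 0 < 1 - z by rewrite subr_gt0.
have oz1 : 1 - z < 1 by rewrite gtrBl.
have d1 : is_derive z 1 (polylog 2) (polylog 1 z / z).
  by apply: is_derive_polylog2; rewrite z0.
have d2 : is_derive z 1 (polylog 2 \o onem) (polylog 1 (1 - z) / (1 - z) * -1).
  apply: is_derive1_comp; first by apply: is_derive_polylog2; rewrite oz0.
  by rewrite -[X in is_derive _ _ _ X]add0r; apply: is_deriveB.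
have d3 := is_derive1_ln z0.
have d4 := is_derive_ln_onem z1.
have := is_deriveD (is_deriveD d1 d2) (is_deriveM d3 d4).
rewrite !polylog1E ?(ltW z0) ?(ltW oz0)// subKr.
rewrite [X in is_derive _ _ _ X -> _](_ : _ = 0)// /GRing.scale/=.
by field; rewrite !gt_eqF.
Qed.

Lemma polylog1_le x : 0 <= x < 1 -> polylog 1 x <= x / (1 - x).
Proof.
move=> x01; rewrite -polylog0E//; apply: ler_lim; [exact: is_cvg_polylog..|].
apply: nearW => n; apply: ler_sum => i _ /=; rewrite /polylog_term.
case/andP: x01 => x0 x1.
rewrite ler_wpM2l ?exprn_ge0// /riemannR powRr0 invr1.
exact: riemannR_le1.
Qed.

(** The left-hand side is constant on ]0, 1[, and its value is found by letting
    the point tend to 0.  From above, Li_2(1 - y^2) <= zeta(2), while Li_2(y^2) and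
    ln (y^2) ln (1 - y^2) are at most linear in y; from below, each partial sum of
    Li_2(1 - y) is within n y of the partial sum of zeta(2), by Bernoulli's
    inequality. *)
Lemma polylog2_reflection x : 0 < x < 1 ->
  polylog 2 x + polylog 2 (1 - x) + ln x * ln (1 - x) = zeta 2.
Proof.
move=> x01; apply/eqP; rewrite eq_le; apply/andP; split.
- apply: (@le_forall_slope _ _ (zeta 2 + 4)).
    by rewrite addr_ge0 ?zeta2_ge0.
  (* The point y^2, because - ln (y^2) <= 2 / y. *)
  move=> y /andP[y0 y2].
  have yy0 : 0 < y ^+ 2 by rewrite exprn_gt0.
  have yy1 : y ^+ 2 < 1 by rewrite expr2; nra.
  rewrite -/(reflection x) (@reflection_cst x (y ^+ 2)) ?yy0// /reflection.
  rewrite [leRHS](_ : _ = zeta 2 * y + zeta 2 + 4 * y); last by ring.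
  apply: lerD; first apply: lerD.
  + apply: le_trans (polylog2_le _) _; first by rewrite !ltW.
    by rewrite ler_wpM2l ?zeta2_ge0// expr2; nra.
  + by apply: polylog2_le_zeta2; rewrite subr_ge0 gerBl !ltW.
  + rewrite lnXn// -mulrNN -[- ln (1 - _)]polylog1E ?(ltW yy0)//.
    have ly : 0 <= - (ln y *+ 2) <= 2 / y.
      rewrite -mulNrn -lnV ?posrE// mulr_natl.
      rewrite mulrn_wge0 ?ln_ge0 ?invf_ge1//; last lra.
      by rewrite lerMn2r/= ltW// ln_sublinear// invr_gt0.
    apply: (@le_trans _ _ (2 / y * (y ^+ 2 / (1 - y ^+ 2)))).
      case/andP: ly => ly0 ly1.
      rewrite ler_pM// ?polylog1_le ?polylog_ge0// ?(ltW yy0)//.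
    rewrite [leLHS](_ : _ = 2 * y / (1 - y ^+ 2)); last first.
      by field; rewrite (gt_eqF y0) gt_eqF// subr_gt0.
    by rewrite ler_pdivrMr ?subr_gt0// expr2; nra.
- rewrite {1}zeta_polylog.
  apply: limr_le; first by apply: is_cvg_polylog2; rewrite ler01 lexx.
  apply: nearW => n.
  apply: (@le_forall_slope _ _ n%:R) => // y /andP[y0 y2].
  have y1 : y < 1 by lra.
  rewrite -/(reflection x) (@reflection_cst x y) ?y0//.
  rewrite -lerBlDr.
  apply: (@le_trans _ _ (series (polylog_term 2 (1 - y)) n)); last first.
    apply: (@le_trans _ _ (polylog 2 (1 - y))).
      apply: polylog_ge; [by []|by lra|].
      by apply: is_cvg_polylog2; lra.
    rewrite /reflection addrAC lerDr addr_ge0//.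
      by apply: polylog_ge0 => //; rewrite ltW.
    by rewrite mulr_le0// ln_le0//; lra.
  have -> : n%:R * y = \sum_(0 <= i < n) y.
    by rewrite sumr_const_nat subn0 mulr_natl.
  rewrite /series/= -sumrB; apply: ler_sum => i _.
  rewrite /polylog_term expr1n mul1r.
  have i0 : 0 < i.+1%:R :> R by rewrite ltr0n.
  have y01 : 0 <= y <= 1 by lra.
  apply: le_trans (ler_wpM2r _ (bernoulli_ineq i.+1 y01)); last first.
    by rewrite ltW// riemannR_gt0.
  rewrite mulrBl mul1r lerD2l lerN2 mulrAC -[leRHS]mul1r.
  rewrite ler_wpM2r ?(ltW y0)//.
  by apply: riemannR_le_inv; lra.
Qed.

End PolylogarithmDerivative.

(** * Products of series as sums over tuples *)

Section SumsOverTuples.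
Context {R : realType}.
Local Open Scope ereal_scope.

(** Numbering the index type turns the sum into an ordinary series, for which
    scaling and termwise integration are available. *)
Lemma esum_pickle (T : countType) (a : T -> \bar R) : (forall x, 0 <= a x) ->
  \esum_(x in [set: T]) a x = \sum_(n <oo) oapp a 0 (pickle_inv n).
Proof.
move=> a0; have b0 n : 0 <= oapp a 0 (@pickle_inv T n).
  by case: pickle_inv => /=.
rewrite nneseries_esumT//.
transitivity (\esum_(n in range (@pickle T)) oapp a 0 (@pickle_inv T n)).
  rewrite esum_image; last by move=> x y _ _ /(pcan_inj (@pickleK_inv T)).
  by apply: eq_esum => x _; rewrite pickleK_inv.
rewrite [LHS]esum_mkcond; apply: eq_esum => n _; case: ifPn => //.
rewrite notin_setE /= => nT; have := @pickle_invK T n.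
by case: pickle_inv => //= x xn; exfalso; apply: nT; exists x.
Qed.

Lemma esumZl (T : countType) (c : R) (a : T -> \bar R) :
  (0 <= c)%R -> (forall x, 0 <= a x) ->
  \esum_(x in [set: T]) (c%:E * a x) = c%:E * \esum_(x in [set: T]) a x.
Proof.
move=> c0 a0; rewrite !esum_pickle//; last by move=> x; rewrite mule_ge0.
rewrite -nneseriesZl//; last by move=> n _; case: pickle_inv => /=.
by apply: eq_eseriesr => n _; case: pickle_inv => //=; rewrite mule0.
Qed.

Lemma esum_ffun_prod n (g : 'I_n -> nat -> R) (G : 'I_n -> R) :
  (forall i k, (0 <= g i k)%R) ->
  (forall i, \sum_(k <oo) (g i k)%:E = (G i)%:E) ->
  \esum_(h in [set: {ffun 'I_n -> nat}]) (\prod_(i < n) g i (h i))%:E =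
  (\prod_(i < n) G i)%:E.
Proof.
elim: n g G => [|n ih] g G g0 gG.
  rewrite (_ : [set: _] = [set [ffun=> 0%N]]).
    by rewrite esum_set1 !big_ord0.
  by apply/seteqP; split => // h _; apply/ffunP => -[].
have G0 i : (0 <= G i)%R.
  by rewrite -lee_fin -gG nneseries_ge0// => k _ _; rewrite lee_fin.
pose cons_ffun (p : nat * {ffun 'I_n -> nat}) : {ffun 'I_n.+1 -> nat} :=
  [ffun i => oapp p.2 p.1 (unlift ord0 i)].
have cons_bij :
    set_bij ([set: nat] `*`` fun=> [set: {ffun 'I_n -> nat}]) setT cons_ffun.
  split => //.
  - move=> [k h] [k' h'] _ _ /= /ffunP E; congr pair.
      by have := E ord0; rewrite !ffunE unlift_none.
    by apply/ffunP => i; have := E (lift ord0 i); rewrite !ffunE liftK.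
  - move=> h _; exists (h ord0, [ffun i => h (lift ord0 i)]) => //.
    apply/ffunP => i; rewrite !ffunE.
    by case: unliftP => [j|] ->//=; rewrite ffunE.
rewrite (reindex_esum _ _ _ _ cons_bij).
transitivity (\esum_(k in [set: nat]) \esum_(h in [set: {ffun 'I_n -> nat}])
    ((g ord0 k)%:E * (\prod_(i < n) g (lift ord0 i) (h i))%:E)).
  rewrite (@esum_esum _ _ _ _ (fun=> [set: _])) => [|k h _ _].
    apply: eq_esum => p _; rewrite big_ord_recl EFinM ffunE unlift_none /=.
    by congr (_ * _%:E); apply: eq_bigr => i _; rewrite ffunE liftK.
  by rewrite mule_ge0// lee_fin// prodr_ge0.
transitivity (\esum_(k in [set: nat])
    ((\prod_(i < n) G (lift ord0 i))%:E * (g ord0 k)%:E)).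
  apply: eq_esum => k _; rewrite esumZl//.
    by rewrite (ih (fun i => g (lift ord0 i)) (fun i => G (lift ord0 i)))// muleC.
  by move=> h; rewrite lee_fin prodr_ge0.
rewrite esumZl ?prodr_ge0//; last by move=> k; rewrite lee_fin.
rewrite -nneseries_esumT; last by move=> k; rewrite lee_fin.
by rewrite gG muleC -EFinM big_ord_recl.
Qed.

End SumsOverTuples.

(** * Integrals of powers of the logarithm *)

Section PowerLogIntegrals.
Context {R : realType}.
Implicit Types (x : R) (N k n : nat).
Notation mu := (@lebesgue_measure R).

Lemma continuous_FTC2_unit (f F : R -> R) (a : R) : 0 < a < 1 ->
  (forall x, 0 < x -> derivable f x 1) ->
  (forall x, 0 < x -> is_derive x 1 F (f x)) ->
  (\int[mu]_(x in `[a, 1%R]) (f x)%:E = (F 1 - F a)%:E)%E.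
Proof.
move=> /andP[a0 a1] df dF.
have dF' x : 0 < x -> derivable F x 1 by move=> /dF[].
have cF x : 0 < x -> {for x, continuous F}.
  by move=> /dF' /derivable1_diffP /differentiable_continuous.
rewrite (@continuous_FTC2 _ f F)// ?EFinB//.
- apply: derivable_within_continuous => x; rewrite in_itv/= => /andP[ax _].
  by apply: df; exact: lt_le_trans ax.
- split.
  + move=> x; rewrite in_itv/= => /andP[ax _].
    by apply: dF'; exact: lt_trans ax.
  + by apply: cvg_at_right_filter; exact: cF.
  + by apply: cvg_at_left_filter; exact: cF.
- move=> x; rewrite in_itv/= => /andP[ax _].
  by rewrite derive1E; have [_ ->] := dF _ (lt_trans a0 ax).
Qed.

(** The recurrence behind the antiderivatives of x^N (- ln x)^k: solve this
    identity for the term with the higher power of the logarithm. *)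
Lemma is_derive_pow_log N k x : 0 < x ->
  is_derive x 1 (fun y => y ^+ N.+1 * (- ln y) ^+ k.+1)
    (N.+1%:R * (x ^+ N * (- ln x) ^+ k.+1) - k.+1%:R * (x ^+ N * (- ln x) ^+ k)).
Proof.
move=> x0.
rewrite (_ : (fun y => _) = (@idfun R ^+ N.+1) * ((- @ln R) ^+ k.+1)); last first.
  by apply/funext => y; rewrite !fctE.
have dl := is_deriveN (is_derive1_ln x0).
have dX := is_deriveX N.+1 (is_derive_id x 1).
apply: (is_derive_eq (is_deriveM dX (is_deriveX k.+1 dl))).
rewrite !fctE /GRing.scale/=.
have -> : x ^+ N.+1 = x * x ^+ N by rewrite exprS.
by field; rewrite gt_eqF.
Qed.

Lemma derivable_pow_log N k x : 0 < x ->
  derivable (fun y : R => y ^+ N * (- ln y) ^+ k) x 1.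
Proof.
move=> x0.
rewrite (_ : (fun y => _) = (@idfun R ^+ N) * ((- @ln R) ^+ k)); last first.
  by apply/funext => y; rewrite !fctE.
apply: derivableM; apply: derivableX; first exact: derivable_id.
by apply: derivableN; have [] := is_derive1_ln x0.
Qed.

(** The points exp (- (n+1)) tend to 0, and along them the logarithm is an
    integer: x (- ln x)^k becomes (n+1)^k / exp (n+1), which the term of degree
    k + 1 of the exponential series bounds by (k+1)! / (n+1). *)
Lemma cvg_exprn_expRN N k :
  expR (- n.+1%:R) ^+ N.+1 * n.+1%:R ^+ k @[n --> \oo] --> (0 : R).
Proof.
apply: (@squeeze_cvgr _ _ _ _ (cst 0)
  (fun n => k.+1`!%:R * (n.+1%:R : R)^-1)).
- apply: nearW => n; rewrite mulr_ge0 ?exprn_ge0 ?expR_ge0//=.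
  have n1 : (0 : R) < n.+1%:R by rewrite ltr0n.
  apply: (@le_trans _ _ (expR (- n.+1%:R) * n.+1%:R ^+ k)).
    by rewrite ler_wpM2r ?exprn_ge0// exprS ler_piMr ?expR_ge0.
  rewrite expRN mulrC ler_pdivrMr ?expR_gt0// mulrAC ler_pdivlMr//.
  rewrite -exprSr mulrC -ler_pdivrMr ?ltr0n ?fact_gt0//.
  by apply: le_trans (expR_ge1Dxn k (ltW n1)); rewrite lerDr.
- exact: cvg_cst.
- rewrite -[X in _ --> X](mulr0 k.+1`!%:R).
  by apply: cvgM; [exact: cvg_cst|exact: cvg_harmonic].
Qed.

Lemma antiderivative_pow_log N k : exists G : R -> R,
  [/\ forall x, 0 < x -> is_derive x 1 G (x ^+ N * (- ln x) ^+ k),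
      G 1 = k`!%:R / N.+1%:R ^+ k.+1 &
      G (expR (- n.+1%:R)) @[n --> \oo] --> (0 : R)].
Proof.
have N0 : N.+1%:R != 0 :> R by rewrite pnatr_eq0.
elim: k => [|k [G [dG G1 Goo]]].
  exists (fun x => N.+1%:R^-1 * x ^+ N.+1); split.
  - move=> x x0.
    rewrite (_ : (fun y => _) = N.+1%:R^-1 \*: (@idfun R ^+ N.+1)); last first.
      by apply/funext => y; rewrite !fctE.
    apply: (is_derive_eq
      (is_deriveZ N.+1%:R^-1 (is_deriveX N.+1 (is_derive_id x 1)))).
    by rewrite /GRing.scale/= expr0 !mulr1 mulrA mulVf// mul1r.
  - by rewrite expr1n mulr1 fact0 mul1r expr1.
  - rewrite -[X in _ --> X](mulr0 N.+1%:R^-1).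
    apply: cvgM; first exact: cvg_cst.
    by have := cvg_exprn_expRN N 0; under eq_fun do rewrite expr0 mulr1.
exists (fun x => N.+1%:R^-1 * (x ^+ N.+1 * (- ln x) ^+ k.+1 + k.+1%:R * G x)).
split.
- move=> x x0.
  rewrite (_ : (fun y => _) = N.+1%:R^-1 \*:
    ((fun y => y ^+ N.+1 * (- ln y) ^+ k.+1) + k.+1%:R \*: G)); last first.
    by apply/funext => y; rewrite !fctE.
  apply: (is_derive_eq (is_deriveZ N.+1%:R^-1
    (is_deriveD (is_derive_pow_log N k x0) (is_deriveZ k.+1%:R (dG x x0))))).
  by rewrite /GRing.scale/= subrK mulKf.
- rewrite ln1 oppr0 expr0n mulr0 add0r G1 factS natrM [in RHS]exprS.
  by rewrite invfM; ring.
- rewrite -[X in _ --> X](mulr0 N.+1%:R^-1).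
  apply: cvgM; first exact: cvg_cst.
  rewrite -[X in _ --> X](addr0 0); apply: cvgD.
    under eq_fun do rewrite expRK opprK.
    exact: cvg_exprn_expRN.
  rewrite -[X in _ --> X](mulr0 k.+1%:R).
  by apply: cvgM; first exact: cvg_cst.
Qed.

Lemma itvoc01_bigcup :
  `]0, 1]%classic = \bigcup_n `[expR (- n.+1%:R), 1]%classic :> set R.
Proof.
apply/seteqP; split => x /=.
  rewrite in_itv/= => /andP[x0 x1].
  have lx : 0 <= - ln x by rewrite oppr_ge0 ln_le0.
  exists (Num.bound (- ln x)) => //=; rewrite in_itv/= x1 andbT.
  rewrite -[leRHS]lnK ?posrE// ler_expR lerNl.
  apply: ltW; apply: lt_le_trans (archi_boundP lx) _.
  by rewrite ler_nat.
by move=> [n _] /=; rewrite !in_itv/= => /andP[/(lt_le_trans (expR_gt0 _))->].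
Qed.

Lemma measurable_pow_log (D : set R) N k :
  measurable_fun D (fun x => x ^+ N * (- ln x) ^+ k).
Proof.
apply: measurable_funM; first exact: measurable_funX.
apply: measurable_funX; apply: measurableT_comp => //.
by apply: measurable_funTS; exact: measurable_ln.
Qed.

Lemma pow_log_ge0 N k x : 0 <= x <= 1 -> 0 <= x ^+ N * (- ln x) ^+ k.
Proof.
by move=> /andP[x0 x1]; rewrite mulr_ge0 ?exprn_ge0// oppr_ge0 ln_le0.
Qed.

Lemma expRN_itv n : 0 < expR (- n.+1%:R : R) < 1.
Proof. by rewrite expR_gt0 expR_lt1 oppr_lt0 ltr0n. Qed.

(** The integrand is unbounded at 0 as soon as N = 0 < k, so the fundamental
    theorem is applied on [exp (- (n+1)), 1], and then n tends to infinity. *)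
Lemma integral_pow_log N k :
  (\int[mu]_(x in `]0%R, 1%R[) (x ^+ N * (- ln x) ^+ k)%:E =
   (k`!%:R / N.+1%:R ^+ k.+1)%:E)%E.
Proof.
have [G [dG G1 Goo]] := antiderivative_pow_log N k.
have mf (D : set R) : measurable_fun D (fun x => (x ^+ N * (- ln x) ^+ k)%:E).
  by apply/measurable_EFinP; exact: measurable_pow_log.
rewrite integral_itv_bndo_bndc//.
rewrite itvoc01_bigcup.
have FTC : (fun n => \int[mu]_(x in `[expR (- n.+1%:R), 1%R])
    (x ^+ N * (- ln x) ^+ k)%:E)%E = fun n => (G 1 - G (expR (- n.+1%:R)))%:E.
  apply/funext => n; apply: continuous_FTC2_unit => //; first exact: expRN_itv.
  by move=> x x0; exact: derivable_pow_log.
have I : ((\int[mu]_(x in `[expR (- n.+1%:R), 1%R])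
      (x ^+ N * (- ln x) ^+ k)%:E) @[n --> \oo] -->
    \int[mu]_(x in \bigcup_n `[expR (- n.+1%:R), 1%R]%classic)
      (x ^+ N * (- ln x) ^+ k)%:E)%E.
  apply: ge0_nondecreasing_set_cvg_integral => //.
  - move=> m n mn; apply/subsetPset => x /=; rewrite !in_itv/=.
    move=> /andP[mx ->]; rewrite andbT; apply: le_trans mx.
    by rewrite ler_expR lerN2 ler_nat.
  - by move=> i; exact: mf.
  - move=> n x /=; rewrite in_itv/= => /andP[/(lt_le_trans (expR_gt0 _)) x0 x1].
    by rewrite lee_fin pow_log_ge0// x1 ltW.
have J : (G 1 - G (expR (- n.+1%:R)))%:E @[n --> \oo] --> (G 1)%:E.
  rewrite -[X in _ --> X%:E](subr0 (G 1)).
  apply: cvg_EFin; first exact: nearW.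
  by apply: cvgB; first exact: cvg_cst.
by rewrite FTC in I; rewrite -G1; exact: cvg_unique I J.
Qed.

Lemma measurable_inv_unit : measurable_fun (`]0, 1[ : set R) (@GRing.inv R).
Proof.
apply: open_continuous_measurable_fun; first exact: interval_open.
move=> x; rewrite inE/= in_itv/= => /andP[x0 _].
by apply: inv_continuous; rewrite gt_eqF.
Qed.

Lemma integral_inv_unit : (\int[mu]_(x in `]0%R, 1%R[) (x^-1)%:E = +oo)%E.
Proof.
have mi : measurable_fun (`]0, 1[ : set R) (fun x : R => (x^-1)%:E).
  by apply/measurable_EFinP; exact: measurable_inv_unit.
have mic := (emeasurable_fun_itv_bndo_bndcP _ _ _).1 mi.
rewrite integral_itv_bndo_bndc//.
apply/eqyP => e e0; set n := Num.bound e.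
apply: (@le_trans _ _ (n.+1%:R : R)%:E).
  rewrite lee_fin ltW// (lt_le_trans (archi_boundP _))// ?ler_nat//.
  exact: ltW.
have -> : (n.+1%:R : R) = ln 1 - ln (expR (- n.+1%:R)).
  by rewrite ln1 expRK opprK add0r.
rewrite -(@continuous_FTC2_unit (fun x => x^-1))//.
- apply: ge0_subset_integral => //=.
    by move=> x; rewrite in_itv/= lee_fin invr_ge0 => /andP[/ltW].
  by move=> x xn; rewrite itvoc01_bigcup; exists n.
- exact: expRN_itv.
- by move=> x x0; apply: derivableV => //; rewrite gt_eqF.
Qed.

End PowerLogIntegrals.

(** * Mordell-Tornheim sums as integrals *)

Section MellinTransform.
Context {R : realType}.
Implicit Types (x : R) (k n : nat).
Notation mu := (@lebesgue_measure R).

Lemma lebesgue_measure_onem (A : set R) : measurable A ->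
  pushforward mu ((fun x : R => 1 - x) : _ -> measurableTypeR R) A = mu A.
Proof.
move=> mA; apply/esym/lebesgue_measure_unique => //=.
  exact: measurable_funB.
move=> _ _ [[a b]] _ <-.
rewrite /pushforward/= (_ : _ @^-1` _ = `[1 - b, 1 - a[%classic); last first.
  by apply/seteqP; split => x /=; rewrite !in_itv/=; lra.
rewrite !lebesgue_measure_itv/= !lte_fin ltrD2l ltrN2; case: ifPn => // _.
by rewrite -!EFinD; congr EFin; ring.
Qed.

Lemma ge0_integral_unit_onem (f : R -> \bar R) :
  measurable_fun (`]0, 1[ : set R) f ->
  (forall x, 0 < x < 1 -> (0 <= f x)%E) ->
  (\int[mu]_(x in `]0%R, 1%R[) f x = \int[mu]_(x in `]0%R, 1%R[) f (1 - x)%R)%E.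
Proof.
move=> mf f0; pose D : set (measurableTypeR R) := `]0, 1[%classic.
have mo : measurable_fun [set: measurableTypeR R]
    ((fun x : R => 1 - x) : _ -> measurableTypeR R).
  exact: measurable_funB.
have DE : ((fun x : R => 1 - x) : _ -> measurableTypeR R) @^-1` D = D.
  by apply/seteqP; split => x; rewrite /D/= !in_itv/=; lra.
rewrite -[X in _ = integral _ X _]DE -(@ge0_integral_pushforward _ _ _ _ _ _ mo mu D f)//=.
- pose nu := @measure_function_pushforward__canonical__measure_function_Measure _ _ _ _ R mu _ mo.
  apply: (@eq_measure_integral _ (measurableTypeR R) R D nu mu f).
  by move=> A mA AS; exact/esym/lebesgue_measure_onem.
- exact: measurable_itv.
- by move=> x /set_mem; rewrite /D/= in_itv/=; exact: f0.
Qed.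

Lemma nneseries_polylog_term a x : 0 <= a -> 0 <= x < 1 ->
  (\sum_(n <oo) (polylog_term a x n)%:E = (polylog a x)%:E)%E.
Proof.
move=> a0 x01; rewrite /polylog -EFin_lim; last exact: is_cvg_polylog.
by congr (limn _); apply/funext => n /=; rewrite sumEFin.
Qed.

Lemma measurable_polylog a : 0 <= a ->
  measurable_fun (`]0, 1[ : set R) (polylog a : R -> R).
Proof.
move=> a0; apply/measurable_EFinP.
apply: (@eq_measurable_fun _ _ _ _ _
    (fun x => \sum_(n <oo) (polylog_term a x n)%:E)%E).
  move=> x; rewrite inE/= in_itv/= => /andP[x0 x1].
  by rewrite nneseries_polylog_term// ltW.
apply: ge0_emeasurable_sum => [n x /=|n _].
  rewrite in_itv/= => /andP[x0 x1] _.
  by rewrite lee_fin polylog_term_ge0// ltW.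
by apply/measurable_EFinP; apply: measurable_funM => //; exact: measurable_funX.
Qed.

(** For a nonempty list the denominators are positive, so the inverse of [\bar R]
    is the one of [R]; the positive indices are shifted to start at 0. *)
Lemma mt_zetaE (s : seq R) (t : R) : (0 < size s)%N ->
  mt_zeta s t = (\esum_(h in [set: {ffun 'I_(size s) -> nat}])
    ((\prod_(i < size s) riemannR s`_i (h i)) *
     ((\sum_(i < size s) (h i).+1)%:R `^ t)^-1)%:E)%E.
Proof.
move=> s0; pose shift (h : {ffun 'I_(size s) -> nat}) := [ffun i => (h i).+1].
have shift_bij : set_bij [set: {ffun 'I_(size s) -> nat}]
    [set k : {ffun 'I_(size s) -> nat} | forall i, (0 < k i)%N] shift.
  split => //=.
  - by move=> h _ i; rewrite ffunE.
  - move=> h h' _ _ /ffunP E; apply/ffunP => i.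
    by have := E i; rewrite !ffunE => -[].
  - move=> h h0; exists [ffun i => (h i).-1] => //.
    by apply/ffunP => i; rewrite !ffunE prednK.
rewrite /mt_zeta (reindex_esum _ _ _ _ shift_bij).
apply: eq_esum => h _.
have sum0 : (0 : R) < (\sum_(i < size s) (h i).+1)%:R.
  case: (size s) s0 h => // n _ h.
  by rewrite ltr0n big_ord_recl.
have -> : \sum_(i < size s) (shift h i)%:R =
    (\sum_(i < size s) (h i).+1)%:R :> R.
  by rewrite natr_sum; apply: eq_bigr => i _; rewrite ffunE.
have prod0 : 0 < \prod_(i < size s) (shift h i)%:R `^ s`_i.
  by apply: prodr_gt0 => i _; rewrite powR_gt0// ffunE ltr0n.
rewrite inver gt_eqF ?mulr_gt0 ?powR_gt0// invfM; congr (_ * _)%:E.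
by rewrite -prodfV; apply: eq_bigr => i _; rewrite ffunE.
Qed.

Lemma mt_zeta_ge0 (s : seq R) (t : R) : (0 <= mt_zeta s t)%E.
Proof.
apply: esum_ge0 => k _; rewrite inve_ge0 lee_fin mulr_ge0 ?powR_ge0//.
by apply: prodr_ge0 => i _; exact: powR_ge0.
Qed.

(** Term by term: the product of the n polylogarithms is the sum, over all tuples
    h, of x^N times the product of the 1 / (h_i + 1)^(s_i), where N is the sum of
    the h_i + 1; and x^(N-1) (- ln x)^k integrates to k! / N^(k+1).  The list must
    be nonempty for N to be positive. *)
Lemma mt_zeta_integral (s : seq R) k : (0 < size s)%N ->
  (forall i, 0 <= s`_i) ->
  ((k`!%:R)%:E * mt_zeta s k.+1%:R = \int[mu]_(x in `]0%R, 1%R[)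
    ((\prod_(i < size s) polylog s`_i x) * ((- ln x) ^+ k / x))%:E)%E.
Proof.
move=> s0 sge0.
pose N (h : {ffun 'I_(size s) -> nat}) := (\sum_(i < size s) (h i).+1)%N.
have N0 h : (0 < N h)%N.
  rewrite /N; case: (size s) s0 h => // n _ h.
  by rewrite big_ord_recl.
pose c (h : {ffun 'I_(size s) -> nat}) := \prod_(i < size s) riemannR s`_i (h i).
have c0 h : 0 <= c h.
  by apply: prodr_ge0 => i _; rewrite ltW// riemannR_gt0.
pose F h x := (c h * (x ^+ (N h).-1 * (- ln x) ^+ k))%:E.
have F0 h x : 0 < x < 1 -> (0 <= F h x)%E.
  move=> /andP[x0 x1]; rewrite /F lee_fin mulr_ge0// pow_log_ge0//.
  by rewrite !ltW.
have mF (D : set R) h : measurable_fun D (F h).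
  apply/measurable_EFinP; apply: measurable_funM => //.
  exact: measurable_pow_log.
transitivity (\int[mu]_(x in `]0%R, 1%R[)
    \sum_(n <oo) oapp (F ^~ x) 0 (pickle_inv n))%E.
  rewrite integral_nneseries//; last 2 first.
  - by move=> n; case: pickle_inv => [h|] /=; [exact: mF|exact: measurable_cst].
  - by move=> n x /=; rewrite in_itv/= => /F0; case: pickle_inv => /=.
  rewrite mt_zetaE// -esumZl//; last first.
    by move=> h; rewrite lee_fin mulr_ge0 ?c0// invr_ge0 powR_ge0.
  rewrite esum_pickle; last first.
    move=> h; rewrite -EFinM lee_fin !mulr_ge0// ?c0// invr_ge0 powR_ge0//.
  apply: eq_eseriesr => n _; case: pickle_inv => [h|] /=; last first.
    by rewrite integral0.
  rewrite /F; under eq_integral do rewrite EFinM.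
  rewrite ge0_integralZl//; last 3 first.
  - by apply/measurable_EFinP; exact: measurable_pow_log.
  - move=> x /=; rewrite in_itv/= => /andP[x0 x1].
    by rewrite lee_fin pow_log_ge0// !ltW.
  - by rewrite lee_fin.
  rewrite integral_pow_log -!EFinM prednK// powR_mulrn//.
  by congr EFin; rewrite /c /N; ring.
apply: eq_integral => x; rewrite inE/= in_itv/= => /[dup] x01 /andP[x0 x1].
have x01' : 0 <= x < 1 by rewrite ltW.
rewrite -(@esum_pickle _ _ (F ^~ x)); last by move=> h; exact: F0.
rewrite mulrC EFinM.
rewrite -(@esum_ffun_prod _ _ (fun i k => polylog_term s`_i x k)); last 2 first.
- by move=> i j; apply: polylog_term_ge0 => //; rewrite ltW.
- by move=> i; exact: nneseries_polylog_term.
rewrite -esumZl; last 2 first.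
- by rewrite divr_ge0 ?(ltW x0)// exprn_ge0// oppr_ge0 ln_le0// ltW.
- move=> h; rewrite lee_fin prodr_ge0// => i _.
  by apply: polylog_term_ge0 => //; rewrite ltW.
apply: eq_esum => h _; rewrite /F -EFinM; congr EFin.
rewrite /polylog_term big_split/= -/(c h).
have -> : \prod_(i < size s) x ^+ (h i).+1 = x ^+ (N h).-1 * x.
  by rewrite -exprSr prednK// /N expr_sum.
by field; rewrite gt_eqF.
Qed.

End MellinTransform.

(** * The integrals of both sides: finiteness and divergence *)

Section DilogarithmIntegrals.
Context {R : realType}.
Implicit Types (x : R) (a j k m n : nat).
Notation mu := (@lebesgue_measure R).

Lemma mt_zeta_integral_seq (s : seq R) k : (0 < size s)%N ->
  all (fun b : R => 0 <= b) s ->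
  ((k`!%:R)%:E * mt_zeta s k.+1%:R = \int[mu]_(x in `]0%R, 1%R[)
    ((\prod_(b <- s) polylog b x) * ((- ln x) ^+ k / x))%:E)%E.
Proof.
move=> s0 /all_nthP sge0; rewrite mt_zeta_integral//.
  by apply: eq_integral => x _; rewrite (big_nth 0) big_mkord.
move=> i; have [/sge0//|si] := ltnP i (size s).
by rewrite nth_default.
Qed.

Lemma prod_nseq n (a : R) (F : R -> R) : \prod_(b <- nseq n a) F b = F a ^+ n.
Proof. by rewrite big_nseq -Monoid.iteropE. Qed.

Let polylog1_onem x : 0 < x < 1 -> polylog 1 (1 - x) = - ln x.
Proof. by move=> x01; rewrite polylog1E ?subKr//; lra. Qed.

Definition direct_kernel j m x : R := polylog 2 x ^+ j * polylog 1 x ^+ m / x.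

(** The last factor is Li_0(x) / x; it stands for the argument 0. *)
Definition reflected_kernel a j k x : R :=
  polylog 2 x ^+ a * polylog 1 x ^+ j * (- ln x) ^+ k / (1 - x).

Lemma mt_zeta_direct j m : (0 < j + m)%N ->
  (mt_zeta (nseq j (2 : R)%R ++ nseq m 1%R) 1%R =
   \int[mu]_(x in `]0%R, 1%R[) (direct_kernel j m x)%:E)%E.
Proof.
move=> jm; have := @mt_zeta_integral_seq (nseq j (2 : R) ++ nseq m 1) 0.
rewrite fact0 mul1e size_cat !size_nseq => -> //.
  apply: eq_integral => x _; rewrite big_cat/= !prod_nseq expr0.
  by rewrite mul1r.
by rewrite all_cat !all_nseq ler0n ler01 !orbT.
Qed.

Lemma mt_zeta_reflected a j k :
  ((k`!%:R)%:E * mt_zeta (nseq a (2 : R)%R ++ nseq j 1%R ++ [:: 0%R]) k.+1%:R =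
   \int[mu]_(x in `]0%R, 1%R[) (reflected_kernel a j k x)%:E)%E.
Proof.
rewrite mt_zeta_integral_seq; last 2 first.
- by rewrite !size_cat !addnA addn1.
- by rewrite !all_cat !all_nseq ler0n ler01 !orbT/= lexx.
apply: eq_integral => x; rewrite inE/= in_itv/= => x01.
rewrite !big_cat/= !prod_nseq big_seq1 polylog0E; last by lra.
by rewrite /reflected_kernel; congr EFin; field; lra.
Qed.

Lemma measurable_direct j m : measurable_fun (`]0, 1[ : set R) (direct_kernel j m).
Proof.
apply: measurable_funM; last exact: measurable_inv_unit.
by apply: measurable_funM; apply: measurable_funX; exact: measurable_polylog.
Qed.

Lemma measurable_inv_onem : measurable_fun (`]0, 1[ : set R) (fun x => (1 - x)^-1).
Proof.
apply: open_continuous_measurable_fun; first exact: interval_open.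
move=> x; rewrite inE/= in_itv/= => x01.
apply: cvgV; first by lra.
by apply: cvgB; [exact: cvg_cst|exact: cvg_id].
Qed.

Lemma measurable_reflected a j k :
  measurable_fun (`]0, 1[ : set R) (reflected_kernel a j k).
Proof.
apply: measurable_funM; last exact: measurable_inv_onem.
apply: measurable_funM; last first.
  rewrite (_ : (fun x => _) = fun x => x ^+ 0 * (- ln x) ^+ k).
    exact: measurable_pow_log.
  by apply/funext => x; rewrite expr0 mul1r.
by apply: measurable_funM; apply: measurable_funX; exact: measurable_polylog.
Qed.

Lemma direct_ge0 j m x : 0 < x < 1 -> 0 <= direct_kernel j m x.
Proof.
move=> x01; have x01' : 0 <= x < 1 by lra.
by rewrite divr_ge0 ?mulr_ge0 ?exprn_ge0 ?polylog_ge0//; lra.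
Qed.

Lemma reflected_ge0 a j k x : 0 < x < 1 -> 0 <= reflected_kernel a j k x.
Proof.
move=> x01; have x01' : 0 <= x < 1 by lra.
by rewrite divr_ge0 ?mulr_ge0 ?exprn_ge0 ?polylog_ge0 ?oppr_ge0 ?ln_le0//; lra.
Qed.

Let le_integral_unit (f g : R -> R) :
  measurable_fun (`]0, 1[ : set R) f -> measurable_fun (`]0, 1[ : set R) g ->
  (forall x, 0 < x < 1 -> 0 <= f x <= g x) ->
  (\int[mu]_(x in `]0%R, 1%R[) (f x)%:E <= \int[mu]_(x in `]0%R, 1%R[) (g x)%:E)%E.
Proof.
move=> mf mg fg; apply: ge0_le_integral => //=.
- by move=> x; rewrite in_itv/= lee_fin => /fg /andP[].
- exact/measurable_EFinP.
- exact/measurable_EFinP.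
- by move=> x; rewrite in_itv/= lee_fin => /fg /andP[].
Qed.

Let integralZ_unit (c : R) (f : R -> R) : 0 <= c ->
  measurable_fun (`]0, 1[ : set R) f -> (forall x, 0 < x < 1 -> 0 <= f x) ->
  (\int[mu]_(x in `]0%R, 1%R[) (c * f x)%:E =
   c%:E * \int[mu]_(x in `]0%R, 1%R[) (f x)%:E)%E.
Proof.
move=> c0 mf f0; under eq_integral do rewrite EFinM.
by rewrite ge0_integralZl//; exact/measurable_EFinP.
Qed.

(** As (- ln x) x <= 1 - x, splitting 1 / (1 - x) = 1 + x / (1 - x) bounds the
    integrand by (- ln x)^m + (- ln x)^(m-1). *)
Lemma reflected00_lty m : (0 < m)%N ->
  (\int[mu]_(x in `]0%R, 1%R[) (reflected_kernel 0 0 m x)%:E < +oo)%E.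
Proof.
case: m => // m _.
apply: (@le_lt_trans _ _ (\int[mu]_(x in `]0%R, 1%R[)
  (x ^+ 0 * (- ln x) ^+ m.+1 + x ^+ 0 * (- ln x) ^+ m)%:E)%E).
  apply: le_integral_unit.
  - exact: measurable_reflected.
  - by apply: measurable_funD; exact: measurable_pow_log.
  move=> x x01; rewrite reflected_ge0//=.
  have ox : 0 < 1 - x by lra.
  rewrite /reflected_kernel !expr0 !mul1r ler_pdivrMr// exprS.
  have l0 : 0 <= (- ln x) ^+ m by rewrite exprn_ge0// oppr_ge0 ln_le0//; lra.
  have lx : - ln x * x <= 1 - x.
    have x0 : 0 < x by lra.
    rewrite -lnV// -ler_pdivlMr// mulrBl mul1r divff ?gt_eqF//.
    rewrite -[X in ln X](subrKC 1); apply: le_ln1Dx.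
    by have : 0 < x^-1 by [rewrite invr_gt0]; lra.
  have := ler_wpM2r l0 lx; lra.
have pl0 k x : 0 < x < 1 -> 0 <= x ^+ 0 * (- ln x) ^+ k.
  by move=> x01; apply: pow_log_ge0; lra.
under eq_integral do rewrite EFinD.
rewrite ge0_integralD//=.
- by rewrite !integral_pow_log -EFinD ltry.
- by move=> x; rewrite in_itv/= lee_fin; exact: pl0.
- by apply/measurable_EFinP; exact: measurable_pow_log.
- by move=> x; rewrite in_itv/= lee_fin; exact: pl0.
- by apply/measurable_EFinP; exact: measurable_pow_log.
Qed.

Let polylog2_exp_le n x : 0 < x < 1 -> polylog 2 x ^+ n <= zeta 2 ^+ n.
Proof.
move=> x01; rewrite lerXn2r ?nnegrE ?zeta2_ge0//.
  by apply: polylog_ge0; lra.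
by apply: polylog2_le_zeta2; lra.
Qed.

(** After Li_2 is bounded by zeta(2), the substitution of 1 - x for x turns
    (- ln (1 - x))^m / x into (- ln x)^m / (1 - x). *)
Lemma direct_lty j m : (0 < m)%N ->
  (\int[mu]_(x in `]0%R, 1%R[) (direct_kernel j m x)%:E < +oo)%E.
Proof.
move=> m0; apply: (@le_lt_trans _ _ (\int[mu]_(x in `]0%R, 1%R[)
  (zeta 2 ^+ j * direct_kernel 0 m x)%:E)%E).
  apply: le_integral_unit; first exact: measurable_direct.
    by apply: measurable_funM => //; exact: measurable_direct.
  move=> x x01; rewrite direct_ge0//= /direct_kernel expr0 mul1r -mulrA.
  rewrite ler_wpM2r ?polylog2_exp_le// divr_ge0 ?exprn_ge0 ?polylog_ge0//; lra.
rewrite integralZ_unit ?exprn_ge0 ?zeta2_ge0//; last 2 first.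
- exact: measurable_direct.
- by move=> x; exact: direct_ge0.
rewrite lte_mul_pinfty ?lee_fin ?exprn_ge0 ?zeta2_ge0//.
rewrite ge0_integral_unit_onem; last 2 first.
- by apply/measurable_EFinP; exact: measurable_direct.
- by move=> x x01; rewrite lee_fin direct_ge0.
rewrite (_ : (\int[_]_(x in _) _)%E =
  \int[mu]_(x in `]0%R, 1%R[) (reflected_kernel 0 0 m x)%:E)%E.
  exact: reflected00_lty.
apply: eq_integral => x; rewrite inE/= in_itv/= => x01.
by rewrite /direct_kernel /reflected_kernel !expr0 !mul1r polylog1_onem.
Qed.

Lemma direct0_lty j : (0 < j)%N ->
  (\int[mu]_(x in `]0%R, 1%R[) (direct_kernel j 0 x)%:E < +oo)%E.
Proof.
move=> j0; apply: (@le_lt_trans _ _ (\int[mu]_(x in `]0%R, 1%R[)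
  (zeta 2 ^+ j * (x ^+ 0 * (- ln x) ^+ 0))%:E)%E).
  apply: le_integral_unit; first exact: measurable_direct.
    by apply: measurable_funM => //; exact: measurable_pow_log.
  move=> x x01; rewrite direct_ge0//= /direct_kernel !expr0 !mulr1.
  have x0 : 0 < x by lra.
  rewrite ler_pdivrMr//.
  apply: (@le_trans _ _ ((zeta 2 * x) ^+ j)).
    rewrite lerXn2r ?nnegrE ?mulr_ge0 ?zeta2_ge0 ?(ltW x0)//.
      by apply: polylog_ge0; lra.
    by apply: polylog2_le; lra.
  rewrite exprMn ler_wpM2l ?exprn_ge0 ?zeta2_ge0//.
  case: j j0 => // j _; rewrite exprS ler_piMr ?(ltW x0)//.
  by rewrite exprn_ile1//; lra.
rewrite integralZ_unit ?exprn_ge0 ?zeta2_ge0//; last 2 first.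
- exact: measurable_pow_log.
- by move=> x x01; apply: pow_log_ge0; lra.
by rewrite integral_pow_log -EFinM ltry.
Qed.

Lemma polylog2_onem x : 0 < x < 1 ->
  zeta 2 - polylog 2 (1 - x) = polylog 2 x + polylog 1 x * (- ln x).
Proof.
move=> x01; rewrite -(polylog2_reflection x01) polylog1E; last by lra.
by ring.
Qed.

(** Each factor Li_1(x) is absorbed by one factor - ln x: by the reflection
    formula their product is at most zeta(2). *)
Lemma reflected_lty a j m : (0 < m)%N ->
  (\int[mu]_(x in `]0%R, 1%R[) (reflected_kernel a j (m + j) x)%:E < +oo)%E.
Proof.
move=> m0; apply: (@le_lt_trans _ _ (\int[mu]_(x in `]0%R, 1%R[)
  (zeta 2 ^+ (a + j) * reflected_kernel 0 0 m x)%:E)%E).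
  apply: le_integral_unit; first exact: measurable_reflected.
    by apply: measurable_funM => //; exact: measurable_reflected.
  move=> x x01; rewrite reflected_ge0//= /reflected_kernel !expr0 !mul1r.
  have l0 : 0 <= - ln x by rewrite oppr_ge0 ln_le0//; lra.
  have x01' : 0 <= x < 1 by lra.
  rewrite !exprD.
  rewrite [leLHS](_ : _ = (polylog 2 x ^+ a * (polylog 1 x * - ln x) ^+ j) *
    ((- ln x) ^+ m / (1 - x))); last by rewrite exprMn; ring.
  rewrite ler_wpM2r ?divr_ge0 ?exprn_ge0//; first lra.
  rewrite ler_pM ?polylog2_exp_le ?exprn_ge0 ?mulr_ge0 ?polylog_ge0//.
  rewrite lerXn2r ?nnegrE ?mulr_ge0 ?polylog_ge0 ?zeta2_ge0//.
  rewrite -(lerD2l (polylog 2 x)) -polylog2_onem//.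
  have p1 : 0 <= polylog 2 (1 - x) by apply: polylog_ge0; lra.
  have p2 : 0 <= polylog 2 x by apply: polylog_ge0; lra.
  lra.
rewrite integralZ_unit ?exprn_ge0 ?zeta2_ge0//; last 2 first.
- exact: measurable_reflected.
- by move=> x; exact: reflected_ge0.
by rewrite lte_mul_pinfty ?lee_fin ?exprn_ge0 ?zeta2_ge0// reflected00_lty.
Qed.

(** As x <= Li_2(x), it is enough that the integral of x^n / (1 - x) diverges.
    After the substitution this is the integral of (1 - x)^n / x, which by
    Bernoulli's inequality is within n of the divergent integral of 1 / x. *)
Lemma reflected0_pinfty n :
  (\int[mu]_(x in `]0%R, 1%R[) (reflected_kernel n 0 0 x)%:E = +oo)%E.
Proof.
pose P x : R := x ^+ n / (1 - x).
have mP : measurable_fun (`]0, 1[ : set R) P.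
  apply: measurable_funM; last exact: measurable_inv_onem.
  exact: measurable_funX.
have P0 x : 0 < x < 1 -> 0 <= P x.
  by move=> x01; rewrite divr_ge0 ?exprn_ge0//; lra.
suff Poo : (\int[mu]_(x in `]0%R, 1%R[) (P x)%:E = +oo)%E.
  apply/eqP; rewrite eq_le leey/= -Poo; apply: le_integral_unit => //.
    exact: measurable_reflected.
  move=> x x01; rewrite P0//= /reflected_kernel !expr0 !mulr1.
  rewrite ler_wpM2r ?invr_ge0//; first lra.
  by rewrite lerXn2r ?nnegrE ?polylog_ge_id ?polylog_ge0//; lra.
have mPo : measurable_fun (`]0, 1[ : set R) (fun x => (1 - x) ^+ n / x).
  apply: measurable_funM; last exact: measurable_inv_unit.
  by apply: measurable_funX; exact: measurable_funB.
have Po0 x : 0 < x < 1 -> 0 <= (1 - x) ^+ n / x.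
  by move=> x01; rewrite divr_ge0 ?exprn_ge0//; lra.
rewrite ge0_integral_unit_onem; [|exact/measurable_EFinP|exact: P0].
rewrite [LHS](_ : _ =
  \int[mu]_(x in `]0%R, 1%R[) ((1 - x) ^+ n / x)%:E)%E; last first.
  by apply: eq_integral => x _; rewrite /P subKr.
have : (\int[mu]_(x in `]0%R, 1%R[) (x^-1)%:E <=
    \int[mu]_(x in `]0%R, 1%R[)
      ((1 - x) ^+ n / x + n%:R * (x ^+ 0 * (- ln x) ^+ 0))%:E)%E.
  apply: le_integral_unit; first exact: measurable_inv_unit.
    apply: measurable_funD => //; apply: measurable_funM => //.
    exact: measurable_pow_log.
  move=> x x01; have x0 : 0 < x by lra.
  rewrite invr_ge0 ltW//= !expr0 !mulr1.
  have x01' : 0 <= x <= 1 by lra.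
  rewrite -[leLHS]mul1r -ler_pdivlMr ?invr_gt0// invrK mulrDl divfK ?gt_eqF//.
  by have := bernoulli_ineq n x01'; lra.
rewrite integral_inv_unit leye_eq => /eqP.
under eq_integral do rewrite EFinD.
have nn x : 0 < x < 1 -> 0 <= n%:R * (x ^+ 0 * (- ln x) ^+ 0).
  by move=> x01; rewrite mulr_ge0// pow_log_ge0//; lra.
rewrite ge0_integralD//=.
- rewrite integralZ_unit// ?integral_pow_log -?EFinM.
  + by case: (integral _ _ _).
  + exact: measurable_pow_log.
  + by move=> x x01; apply: pow_log_ge0; lra.
- exact/measurable_EFinP.
- apply/measurable_EFinP; apply: measurable_funM => //.
  exact: measurable_pow_log.
Qed.

End DilogarithmIntegrals.

(** * The identity *)

Section Identity.
Context {R : realType}.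
Implicit Types (x : R) (a j k m n : nat).
Notation mu := (@lebesgue_measure R).

Lemma pochhammer_fact m j :
  (pochhammer (m + 1)%N%:R j : R) = (m + j)`!%:R / m`!%:R.
Proof.
have m0 k : (k`!%:R : R) != 0 by rewrite pnatr_eq0 -lt0n fact_gt0.
elim: j => [|j ih]; first by rewrite /pochhammer big_ord0 addn0 divff.
rewrite /pochhammer big_ord_recr/= -/(pochhammer _ j) ih -natrD addn1 addSn.
by rewrite addnS factS natrM; ring.
Qed.

Lemma integrable_direct j m : (0 < m)%N ->
  mu.-integrable `]0%R, 1%R[ (EFin \o direct_kernel j m).
Proof.
move=> m0; apply/integrableP; split.
  by apply/measurable_EFinP; exact: measurable_direct.
rewrite [ltLHS](_ : _ =
  \int[mu]_(x in `]0%R, 1%R[) (direct_kernel j m x)%:E)%E; first exact: direct_lty.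
apply: eq_integral => x; rewrite inE/= in_itv/= => x01.
by rewrite ger0_norm// direct_ge0.
Qed.

(** The common value is the integral of W.  Integrability of the summands is
    needed on the left only, where the coefficients alternate in sign. *)
Lemma sum_direct_reflected n m : (0 < m)%N ->
  (\sum_(j < n.+1) ('C(n, j)%:R * ((-1) ^+ j * zeta 2 ^+ (n - j) / m`!%:R))%:E *
     \int[mu]_(x in `]0%R, 1%R[) (direct_kernel j m x)%:E =
   \sum_(j < n.+1) ('C(n, j)%:R / m`!%:R)%:E *
     \int[mu]_(x in `]0%R, 1%R[) (reflected_kernel (n - j) j (m + j) x)%:E)%E.
Proof.
move=> m0.
pose c j : R := 'C(n, j)%:R * ((-1) ^+ j * zeta 2 ^+ (n - j) / m`!%:R).
pose W x : R := (zeta 2 - polylog 2 x) ^+ n * direct_kernel 0 m x / m`!%:R.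
have WE x : W x = \sum_(j < n.+1) c j * direct_kernel j m x.
  rewrite /W exprDn !mulr_suml; apply: eq_bigr => j _.
  rewrite -mulr_natl exprNn /c /direct_kernel expr0; ring.
have mW : measurable_fun (`]0, 1[ : set R) W.
  apply: measurable_funM => //; apply: measurable_funM.
    apply: measurable_funX; apply: measurable_funB => //.
    exact: measurable_polylog.
  exact: measurable_direct.
have W0 x : 0 < x < 1 -> 0 <= W x.
  move=> x01; rewrite divr_ge0// mulr_ge0 ?direct_ge0// exprn_ge0// subr_ge0.
  by apply: polylog2_le_zeta2; lra.
transitivity (\int[mu]_(x in `]0%R, 1%R[) (W x)%:E)%E.
  under eq_integral do rewrite WE -sumEFin.
  rewrite integral_sum//; last first.
    by move=> j; exact: (integrableZl _ (c j) (integrable_direct j m0)).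
  apply: eq_bigr => j _; under [RHS]eq_integral do rewrite EFinM.
  by rewrite integralZl//; exact: integrable_direct.
rewrite ge0_integral_unit_onem; [|exact/measurable_EFinP|exact: W0].
transitivity (\int[mu]_(x in `]0%R, 1%R[) (\sum_(j < n.+1)
    ('C(n, j)%:R / m`!%:R * reflected_kernel (n - j) j (m + j) x)%:E))%E.
  apply: eq_integral => x; rewrite inE/= in_itv/= => x01.
  rewrite /W polylog2_onem// /direct_kernel expr0 mul1r.
  rewrite (_ : polylog 1 (1 - x) = - ln x); last first.
    by rewrite polylog1E ?subKr//; lra.
  rewrite exprDn sumEFin !mulr_suml; congr EFin; apply: eq_bigr => j _.
  by rewrite -mulr_natl exprMn /reflected_kernel [_ ^+ (m + j)]exprD; ring.
rewrite ge0_integral_sum//.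
- apply: eq_bigr => j _; under eq_integral do rewrite EFinM.
  rewrite ge0_integralZl//.
  + by apply/measurable_EFinP; exact: measurable_reflected.
  + by move=> x /=; rewrite in_itv/= lee_fin; exact: reflected_ge0.
- move=> j; apply/measurable_EFinP; apply: measurable_funM => //.
  exact: measurable_reflected.
- move=> j x /=; rewrite in_itv/= lee_fin => x01.
  by rewrite mulr_ge0// reflected_ge0.
Qed.

Lemma mt_zeta_nil : mt_zeta [::] 1 = +oo%E :> \bar R.
Proof.
rewrite /mt_zeta (_ : [set k | _] = [set [ffun=> 0%N]]).
  by rewrite esum_set1 !big_ord0 powR0 ?oner_neq0// mulr0 inve0.
by apply/seteqP; split => k /= _; [apply/ffunP|]; case.
Qed.

Lemma zeta2_gt0 : 0 < zeta (2 : R).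
Proof.
rewrite zeta_polylog; apply: (@lt_le_trans _ _ (series (polylog_term 2 1) 1)).
  by rewrite /series/= big_nat1 /polylog_term expr1n mul1r riemannR_gt0.
by apply: polylog_ge => //; apply: is_cvg_polylog2; rewrite ler01 lexx.
Qed.

Lemma mt_zeta_direct_lty j m : (0 < j + m)%N ->
  (mt_zeta (nseq j (2 : R)%R ++ nseq m 1%R) 1%R < +oo)%E.
Proof.
move=> jm; rewrite mt_zeta_direct//; case: m jm => [|m _]; last exact: direct_lty.
by rewrite addn0; exact: direct0_lty.
Qed.

Lemma mt_zeta_reflected_lty a j m : (0 < m)%N ->
  (mt_zeta (nseq a (2 : R)%R ++ nseq j 1%R ++ [:: 0%R]) (m + 1 + j)%N%:R%R
    < +oo)%E.
Proof.
move=> m0; have := @reflected_lty R a j m m0; rewrite -mt_zeta_reflected.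
rewrite addn1 addSn; have := mt_zeta_ge0 (nseq a (2 : R) ++ nseq j 1 ++ [:: 0])
  (m + j).+1%:R.
case: mt_zeta => [v|_|//]; first by move=> *; rewrite ltry.
by rewrite gt0_muley// lte_fin ltr0n fact_gt0.
Qed.

Lemma mt_zeta_reflected_pinfty n :
  (mt_zeta (nseq n (2 : R)%R ++ [:: 0%R]) 1%R = +oo)%E.
Proof.
by rewrite -(reflected0_pinfty n) -mt_zeta_reflected fact0 mul1e.
Qed.

End Identity.

Theorem corollary9 (R : realType) (r m : nat) (hr : (1 <= r)%N) :
  ((1 <= m)%N -> forall j : nat, (j < r)%N ->
     (mt_zeta (R := R) (nseq j 2%R ++ nseq m 1%R) 1%R < +oo)%E /\
     (mt_zeta (R := R) (nseq (r - 1 - j) 2%R ++ nseq j 1%R ++ [:: 0%R])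
        (m + 1 + j)%N%:R%R < +oo)%E) /\
  (\sum_(j < r)
     ('C(r - 1, j)%:R * ((-1) ^+ j * zeta 2 ^+ (r - 1 - j) / m`!%:R))%R%:E
       * mt_zeta (R := R) (nseq j 2%R ++ nseq m 1%R) 1%R)%E =
  (\sum_(j < r)
     ('C(r - 1, j)%:R * pochhammer (m + 1)%N%:R j)%R%:E
       * mt_zeta (R := R) (nseq (r - 1 - j) 2%R ++ nseq j 1%R ++ [:: 0%R])
           (m + 1 + j)%N%:R%R)%E.
Proof.
case: r hr => // n _; rewrite subn1/=; split=> [m0 j _|].
  by split; [apply: mt_zeta_direct_lty; rewrite addn_gt0 m0 orbT|
    exact: mt_zeta_reflected_lty].
have [->|m0] := posnP m; last first.
  under eq_bigr => j _ do rewrite mt_zeta_direct ?addn_gt0 ?m0 ?orbT//.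
  rewrite sum_direct_reflected//; apply: eq_bigr => j _.
  rewrite -mt_zeta_reflected muleA -EFinM pochhammer_fact addn1 addSn.
  by congr (_%:E * _)%E; ring.
(* Only the term j = 0 on the left is infinite, so the signs of the others cannot
   produce +oo - oo. *)
rewrite !big_ord_recl /= bin0 expr0 subn0 !mul1r fact0 divr1.
rewrite mt_zeta_nil gt0_muley ?lte_fin ?exprn_gt0 ?zeta2_gt0//.
rewrite /pochhammer big_ord0 mul1e mt_zeta_reflected_pinfty.
rewrite [LHS]addye ?[RHS]addye//.
- rewrite -ltNye; apply: lt_le_trans (ltNyr 0) _.
  apply: sume_ge0 => j _; rewrite mule_ge0 ?mt_zeta_ge0// lee_fin mulr_ge0//.
  by apply: prodr_ge0 => i _; rewrite -natrD.
- suff /fin_numP[] : (\sum_(i < n)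
      ('C(n, bump 0 i)%:R * ((-1) ^+ bump 0 i * zeta 2 ^+ (n - bump 0 i) / 1%:R)
      : R)%:E * mt_zeta (nseq (bump 0 i) (2 : R)%R ++ [::]) 1%R)%E \is a fin_num by [].
  apply/sum_fin_numP => i _ _; rewrite fin_numM// ge0_fin_numE ?mt_zeta_ge0//.
  exact: (@mt_zeta_direct_lty _ _ 0).
Qed.
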